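(* The map $\sigma\mapsto\mathcal{E}(\sigma)$ defines a bijection between the smooth permutations in $S_n$ and the subsets $E\subseteq[n-1]\times[n-1]$ satisfying the property that for every two distinct points $(i_1,j_1)$ and $(i_2,j_2)$ in $E$ such that $\min(i_2,j_2)\ge\min(i_1,j_1)$ we have $$i_2\ge i_1,\quad j_2\ge j_1,\quad \max(i_2,j_2)>\max(i_1,j_1)\quad\text{and}\quad\min(i_2,j_2)>\min(i_1,j_1).$$
   Context: $S_n$ is the group of permutations of $[n]=\{1,\dots,n\}$, $n\ge1$, with the Bruhat order: $\tau\le\sigma$ iff $\#(\tau([i])\cap[j])\ge\#(\sigma([i])\cap[j])$ for all $i,j\in[n]$. A permutation $\sigma$ is smooth if $\#\{i<j:\sigma(i)>\sigma(j)\}$ equals the number of transpositions $T\in S_n$ with $T\le\sigma$ (equivalently, as is known, $\sigma$ avoids $4231$ and $3412$). For $\sigma\in S_n$, $\mathcal{E}(\sigma)$ is the set of pairs $(i,j)\in[n-1]\times[n-1]$ such that $\sigma(i)\le j<\sigma(i+1)$ and $\sigma^{-1}(j)\le i<\sigma^{-1}(j+1)$. *)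

(* Defs.v *)
From mathcomp Require Import all_boot all_fingroup.

Set Implicit Arguments.
Unset Strict Implicit.
Unset Printing Implicit Defensive.

(* Everything is 0-based: the element k of [n] is the ordinal k - 1 of 'I_n,   *)
(* and the element i of [n-1] is the ordinal i - 1 of 'I_n.-1.                 *)

(* The subset {1, ..., i} of [n], for i in [n]. *)
Definition initial (n : nat) (i : 'I_n) : {set 'I_n} := [set k : 'I_n | k <= i].

Definition bruhat_le (n : nat) (t s : 'S_n) : bool :=
  [forall i : 'I_n, forall j : 'I_n,
     #|(t @: initial i) :&: initial j| >= #|(s @: initial i) :&: initial j|].

Definition inversions (n : nat) (s : 'S_n) : {set 'I_n * 'I_n} :=
  [set p : 'I_n * 'I_n | (p.1 < p.2) && (s p.1 > s p.2)].

Definition is_transposition (n : nat) (t : 'S_n) : bool :=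
  [exists x : 'I_n, exists y : 'I_n, (x != y) && (t == tperm x y)].

Definition smooth (n : nat) (s : 'S_n) : bool :=
  #|inversions s| == #|[set t : 'S_n | is_transposition t && bruhat_le t s]|.

(* The inclusion i |-> i and the shift i |-> i + 1 from [n-1] to [n]. *)
Definition ord_incl (n : nat) (i : 'I_n.-1) : 'I_n := widen_ord (leq_pred n) i.

Lemma ord_shift_proof (n : nat) (i : 'I_n.-1) : i.+1 < n.
Proof. by rewrite -ltn_predRL. Qed.

Definition ord_shift (n : nat) (i : 'I_n.-1) : 'I_n :=
  Ordinal (ord_shift_proof i).

Definition Eset (n : nat) (s : 'S_n) : {set 'I_n.-1 * 'I_n.-1} :=
  [set p : 'I_n.-1 * 'I_n.-1 |
     (s (ord_incl p.1) <= p.2 < s (ord_shift p.1)) &&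
     ((s^-1)%g (ord_incl p.2) <= p.1 < (s^-1)%g (ord_shift p.2))].

Definition admissible (n : nat) (E : {set 'I_n.-1 * 'I_n.-1}) : Prop :=
  forall i1 j1 i2 j2 : 'I_n.-1,
    (i1, j1) \in E -> (i2, j2) \in E -> (i1, j1) <> (i2, j2) ->
    minn i2 j2 >= minn i1 j1 ->
    [/\ i2 >= i1, j2 >= j1, maxn i2 j2 > maxn i1 j1 & minn i2 j2 > minn i1 j1].

(* Main.v *)
Require Import Defs.
From mathcomp Require Import all_boot all_fingroup zify.

(* For a < b, the transposition (a b) is below s iff some p <= a has s(p) >= b and some v <= a
   has s^-1(v) >= b. Delete the largest value n, at position k, from s; up to replacing s by its
   inverse, s(n) <= k. The number of inversions drops by n - k, while the number of
   transpositions below s drops by at least n - k. Hence inversions never outnumber these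
   transpositions, and if s is smooth then so is the deleted permutation s', with the same
   transpositions among the remaining points. By induction E(s') is admissible and each of its
   points (i, j) is an inclusion: s'([i]) is contained in [j] or s'^-1([j]) in [i]. The equality
   of the transpositions then forces s to decrease from position k on, so that E(s) is E(s'),
   possibly with the further point (k - 1, n - 1). Conversely, an admissible E
   tells through its last point where to insert n, which gives surjectivity. Injectivity holds
   because the rank conditions at the points of E(s) imply all the rank conditions of s. *)

Set Implicit Arguments.
Unset Strict Implicit.
Unset Printing Implicit Defensive.

(** * Permutations and their counts on natural numbers *)

(* A permutation of {0, ..., n - 1} and its inverse, as functions on [nat] that are
   unconstrained outside of this range. *)
Definition perm_pair (n : nat) (f g : nat -> nat) : Prop :=
  forall i, i < n -> [/\ f i < n, g i < n, g (f i) = i & f (g i) = i].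

(** The set [Eset] read on [nat]: a variant of Fulton's essential set, with reversed
    inequalities. *)
Definition essential (n : nat) (f g : nat -> nat) (i j : nat) : bool :=
  [&& i.+1 < n, j.+1 < n, f i <= j < f i.+1 & g j <= i < g j.+1].

(** Gasharov and Reiner's permutations defined by inclusions: at each essential point the number of
    [p <= i] with [f p <= j] is the largest possible, [minn i.+1 j.+1]. *)
Definition by_inclusions (n : nat) (f g : nat -> nat) : Prop :=
  forall i j, essential n f g i j ->
    (i <= j -> forall p, p <= i -> f p <= j) /\
    (j <= i -> forall v, v <= j -> g v <= i).

Definition admissible_rel (E : nat -> nat -> bool) : Prop :=
  forall i1 j1 i2 j2, E i1 j1 -> E i2 j2 -> (i1, j1) <> (i2, j2) ->
    minn i1 j1 <= minn i2 j2 ->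
    [/\ i1 <= i2, j1 <= j2, maxn i1 j1 < maxn i2 j2 & minn i1 j1 < minn i2 j2].

Definition reaches (f : nat -> nat) (a b : nat) : bool :=
  has (fun p => b <= f p) (iota 0 a.+1).

Definition tperm_below (f g : nat -> nat) (a b : nat) : bool :=
  [&& a < b, reaches f a b & reaches g a b].

Definition inv_count (n : nat) (f : nat -> nat) : nat :=
  \sum_(i < n) \sum_(j < n) ((i < j) && (f j < f i)).

Definition tperm_count (n : nat) (f g : nat -> nat) : nat :=
  \sum_(a < n) \sum_(b < n) tperm_below f g a b.

(* [f] arises from the permutation [f'] by inserting the value [n] at position [k]. *)
Definition inserted (n k : nat) (f' g' f g : nat -> nat) : Prop :=
  [/\ k <= n, f k = n, g n = k, forall p, p < n -> f (bump k p) = f' p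
    & forall v, v < n -> g v = bump k (g' v)].

Lemma reachesP f a b :
  reflect (exists2 p, p <= a & b <= f p) (reaches f a b).
Proof.
apply: (iffP hasP) => -[p pa fp]; exists p => //; last by rewrite mem_iota.
by rewrite mem_iota in pa.
Qed.

(** * Symmetry under inversion *)

Lemma perm_pairC n f g : perm_pair n f g -> perm_pair n g f.
Proof. by move=> fg i /fg[]. Qed.

Lemma essentialC n f g i j : essential n g f j i = essential n f g i j.
Proof. by rewrite /essential andbCA andbA [in RHS]andbA [X in _ && X]andbC. Qed.

Lemma by_inclusionsC n f g : by_inclusions n f g -> by_inclusions n g f.
Proof. by move=> fg i j; rewrite essentialC => /fg[]. Qed.

Lemma admissible_relC E : admissible_rel E -> admissible_rel (fun i j => E j i).
Proof.
move=> adE i1 j1 i2 j2 E1 E2 ne le12.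
have ne' : (j1, i1) <> (j2, i2) by case=> ? ?; apply: ne; congr pair.
have le12' : minn j1 i1 <= minn j2 i2 by rewrite minnC [leqRHS]minnC.
by have [? ? ? ?] := adE _ _ _ _ E1 E2 ne' le12'; split; lia.
Qed.

Lemma tperm_countC n f g : tperm_count n f g = tperm_count n g f.
Proof.
apply: eq_bigr => a _; apply: eq_bigr => b _.
by rewrite /tperm_below [reaches f _ _ && _]andbC.
Qed.

Lemma perm_pair_reindex n f g : perm_pair n f g ->
  forall F : nat -> nat, \sum_(i < n) F i = \sum_(i < n) F (f i).
Proof.
move=> fg F; have fP (i : 'I_n) : f i < n by have [] := fg i (ltn_ord i).
rewrite (reindex_inj (h := fun i => Ordinal (fP i))) //.
move=> i j /(congr1 val) /= /(congr1 g).
by have [_ _ -> _] := fg i (ltn_ord i); have [_ _ -> _] := fg j (ltn_ord j) => /val_inj.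
Qed.

(** An inversion of [f] at positions [i < j] is an inversion of [g] at [f j < f i]. *)
Lemma inv_countC n f g : perm_pair n f g -> inv_count n f = inv_count n g.
Proof.
move=> fg; rewrite /inv_count.
rewrite (perm_pair_reindex (perm_pairC fg) (fun i => \sum_(j < n) ((i < j) && (f j < f i)))).
under eq_bigr => i _ do
  rewrite (perm_pair_reindex (perm_pairC fg) (fun j => (g i < j) && (f j < f (g i)) : nat)).
rewrite exchange_big; apply: eq_bigr => i _; apply: eq_bigr => j _.
have [_ _ _ ->] := fg i (ltn_ord i); have [_ _ _ ->] := fg j (ltn_ord j).
by rewrite andbC.
Qed.

(** * Deleting and inserting the largest value *)

Lemma deleted_perm n f g : perm_pair n.+1 f g ->
  exists f' g', perm_pair n f' g' /\ inserted n (g n) f' g' f g.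
Proof.
move=> fg; have [_ gn _ fgn] := fg n (ltnSn n).
exists (fun p => f (bump (g n) p)), (fun v => unbump (g n) (g v)).
have gneq v : v < n -> g v != g n.
  by move=> vn; apply/eqP => /(congr1 f); have [_ _ _ ->] := fg v ltac:(lia); lia.
have fneq p : p < n -> f (bump (g n) p) < n.
  move=> pn; have bp : bump (g n) p < n.+1 by rewrite /bump; lia.
  have [fb _ gfb _] := fg _ bp; rewrite ltn_neqAle -ltnS fb andbT.
  by apply/eqP => e; move: gfb; rewrite e => /eqP; rewrite (negPf (neq_bump _ _)).
split; last first.
  split=> // v vn; rewrite unbumpK // inE; exact: gneq.
move=> i ltin; have [fi gi gfi fgi] := fg i ltac:(lia).
have bi : bump (g n) i < n.+1 by rewrite /bump; lia.
have [_ _ gfb _] := fg _ bi.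
split; first exact: fneq.
- by have := gneq _ ltin; rewrite /unbump; lia.
- by rewrite gfb bumpK.
- by rewrite unbumpK // inE; exact: gneq.
Qed.

Lemma insert_perm n k f' g' : k <= n -> perm_pair n f' g' ->
  exists f g, perm_pair n.+1 f g /\ inserted n k f' g' f g.
Proof.
move=> kn fg'.
exists (fun p => if p == k then n else f' (unbump k p)),
       (fun v => if v == n then k else bump k (g' v)).
split; last first.
  split; rewrite ?eqxx // => i ltin; last by case: eqP => //; lia.
  by rewrite eq_sym (negPf (neq_bump _ _)) bumpK.
move=> i; rewrite ltnS => lein; split.
- case: eqP => // ik; have ui : unbump k i < n by rewrite /unbump; lia.
  by have [] := fg' _ ui; lia.
- case: eqP => // ni; have [] := fg' i ltac:(lia); rewrite /bump; lia.
- case: (i =P k) => [->|ik]; first by rewrite eqxx.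
  have ui : unbump k i < n by rewrite /unbump; lia.
  have [fu _ gfu _] := fg' _ ui; rewrite gfu unbumpK ?inE; last exact/eqP.
  by case: eqP => //; lia.
- case: (i =P n) => [->|ni]; first by rewrite eqxx.
  rewrite eq_sym (negPf (neq_bump _ _)) bumpK.
  by have [] := fg' i ltac:(lia).
Qed.

Lemma sum_geq n k : k <= n -> \sum_(j < n) (k <= j) = n - k.
Proof.
elim: n => [|m IH] km; first by rewrite big_ord0.
rewrite big_ord_recr /=; case: (ltnP m k) => mk; last by rewrite IH //; lia.
rewrite big1 => [|i _]; first by lia.
by have := ltn_ord i; lia.
Qed.

Section Insertion.

Variables (n k : nat) (f' g' f g : nat -> nat).
Hypotheses (fg' : perm_pair n f' g') (ins : inserted n k f' g' f g).

(** The value [n] is inverted exactly with the [n - k] entries to its right. *)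
Lemma inv_count_inserted : inv_count n.+1 f = inv_count n f' + (n - k).
Proof.
have [kn fk gn fE _] := ins.
pose k0 := Ordinal (kn : k < n.+1).
rewrite /inv_count (bigD1_ord k0) //= addnC; congr (_ + _).
  apply: eq_bigr => i _; rewrite (bigD1_ord k0) //= fk fE //.
  have [fi _ _ _] := fg' (ltn_ord i).
  (* Column [k] contributes nothing: no other value exceeds [n]. *)
  rewrite [n < _]ltnNge (ltnW fi) andbF add0n; apply: eq_bigr => j _.
  by rewrite fE // !ltnNge leq_bump2.
rewrite (bigD1_ord k0) //= ltnn add0n.
transitivity (\sum_(j < n) (k <= j)).
  apply: eq_bigr => j _; rewrite fE // fk; have [-> _ _ _] := fg' (ltn_ord j).
  by rewrite andbT /bump; lia.
exact: sum_geq.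
Qed.

Lemma inserted_lt p : p < k -> f p = f' p.
Proof.
have [kn _ _ fE _] := ins.
by move=> pk; rewrite -fE ?(leq_trans pk) //; congr f; rewrite /bump; lia.
Qed.

Lemma inserted_ge p : k <= p -> p < n -> f p.+1 = f' p.
Proof.
have [_ _ _ fE _] := ins.
by move=> kp pn; rewrite -fE //; congr f; rewrite /bump; lia.
Qed.

(** Inserting [n] only pushes positions to the right, which helps [g]. A witness for [f] at a
    position [p >= k] is replaced by [k] itself, where the value is [n]. *)
Lemma tperm_below_inserted a b :
  b < n -> tperm_below f' g' a b -> tperm_below f g a b.
Proof.
have [kn fk gn fE gE] := ins.
move=> bn /and3P[ab /reachesP[p pa bfp] /reachesP[v va bgv]].
apply/and3P; split=> //; apply/reachesP; last first.
  by exists v => //; rewrite gE /bump; lia.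
case: (ltnP p k) => [pk|kp]; first by exists p => //; rewrite inserted_lt.
by exists k; lia.
Qed.

Hypothesis fg : perm_pair n.+1 f g.

(** The value [n] is taken by [f] only at [k] and by [g] only at [f n], so [(a n)] is below exactly
    when [maxn k (f n) <= a < n]. *)
Lemma tperm_count_inserted_split :
  tperm_count n.+1 f g =
  \sum_(a < n) \sum_(b < n) tperm_below f g a b + (n - maxn k (f n)).
Proof.
have [kn fk gn fE gE] := ins.
rewrite /tperm_count big_ord_recr /= [X in _ + X]big1 ?addn0 => [|b _]; last first.
  by have := ltn_ord b; rewrite /tperm_below; case: ltnP => //; lia.
under eq_bigr do rewrite big_ord_recr /=.
rewrite big_split /=; congr (_ + _).
have [fn _ gfn _] := fg (ltnSn n).
transitivity (\sum_(a < n) (maxn k (f n) <= a)).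
  apply: eq_bigr => a _; congr nat_of_bool; have an := ltn_ord a.
  rewrite /tperm_below an /= geq_max; congr andb.
    apply/reachesP/idP => [[p pa np]|ka]; last by exists k; lia.
    have [fp _ gfp _] := fg (ltac:(lia) : p < n.+1).
    by have fpn : f p = n by [lia]; move: gfp; rewrite fpn gn; lia.
  apply/reachesP/idP => [[v va nv]|fna]; last by exists (f n); lia.
  have [_ gv _ fgv] := fg (ltac:(lia) : v < n.+1).
  by have gvn : g v = n by [lia]; move: fgv; rewrite gvn; lia.
by apply: sum_geq; lia.
Qed.
End Insertion.

(** * Inversions never outnumber transpositions *)

(** Up to inversion [f n <= k] with [k = g n]. The [n - k] inversions lost by deleting [n] are then
    matched by the transpositions [(a n)] with [k <= a]. *)
Lemma leq_inv_tperm_count n f g :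
  perm_pair n f g -> inv_count n f <= tperm_count n f g.
Proof.
elim: n f g => [|n IH] f g fg; first by rewrite /inv_count big_ord0.
wlog fngn : f g fg / f n <= g n.
  move=> WL; case: (leqP (f n) (g n)) => [|/ltnW]; first exact: WL.
  by rewrite (inv_countC fg) tperm_countC; apply: WL; apply: perm_pairC.
have [f' [g' [fg' ins]]] := deleted_perm fg.
rewrite (inv_count_inserted fg' ins) (tperm_count_inserted_split ins fg).
rewrite (maxn_idPl fngn) leq_add2r (leq_trans (IH _ _ fg')) //.
apply: leq_sum => a _; apply: leq_sum => b _.
by have := tperm_below_inserted ins (ltn_ord b) (a := a); case: tperm_below => // ->.
Qed.

Definition smooth_pair n f g := inv_count n f = tperm_count n f g.

Lemma smooth_pairC n f g :
  perm_pair n f g -> smooth_pair n f g -> smooth_pair n g f.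
Proof. by move=> fg; rewrite /smooth_pair tperm_countC -(inv_countC fg). Qed.

(** The inversions of [f'], the transpositions below [f'], and those below [f] that fix [n] form an
    increasing chain whose ends agree by smoothness, so all its terms are equal. *)
Lemma smooth_deleted n k f' g' f g :
  perm_pair n f' g' -> perm_pair n.+1 f g -> inserted n k f' g' f g ->
  f n <= k -> smooth_pair n.+1 f g ->
  smooth_pair n f' g' /\
  forall a b, a < n -> b < n -> tperm_below f g a b -> tperm_below f' g' a b.
Proof.
move=> fg' fg ins fnk; rewrite /smooth_pair.
rewrite (inv_count_inserted fg' ins) (tperm_count_inserted_split ins fg).
rewrite (maxn_idPl fnk) => /addIn e.
have ge a b : b < n -> tperm_below f' g' a b <= tperm_below f g a b.
  by move=> bn; have := tperm_below_inserted ins bn (a := a); case: tperm_below => // ->.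
have le1 := leq_inv_tperm_count fg'; rewrite e in le1.
(* Equality of the sums is passed on to their terms, first in [a] and then in [b]. *)
have geS (a : 'I_n) : true -> \sum_(b < n) tperm_below f' g' a b <= \sum_(b < n) tperm_below f g a b
     ?= iff (\sum_(b < n) tperm_below f' g' a b == \sum_(b < n) tperm_below f g a b).
  by move=> _; split=> //; apply: leq_sum => b _; apply: ge.
have [le2 eq2] := leqif_sum geS.
have e2 : tperm_count n f' g' = \sum_(a < n) \sum_(b < n) tperm_below f g a b.
  by apply/eqP; rewrite eqn_leq le1 le2.
split; first by rewrite e e2.
move=> a b an bn; move/eqP: e2; rewrite eq2 => /forallP/(_ (Ordinal an)) /= e3.
have geS' (c : 'I_n) : true -> tperm_below f' g' a c <= tperm_below f g a c
     ?= iff (tperm_below f' g' a c == tperm_below f g a c).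
  move=> _; split; first exact: ge.
  by do 2!case: tperm_below.
have [_ eq3] := leqif_sum geS'.
by move: e3; rewrite eq3 => /forallP/(_ (Ordinal bn)) /= /eqP ->.
Qed.

(** * Essential points from ascents and records *)

(** Take [j.+1] to be the least value above [f q] that occurs after position [q]. It is at most
    [f q.+1], and by minimality [j] occurs at a position up to [q]. *)
Lemma essential_of_ascent n f g q : perm_pair n f g ->
  q.+1 < n -> f q < f q.+1 -> exists j, essential n f g q j.
Proof.
move=> fg qn fq; have [fq1 _ gfq1 _] := fg _ qn; have [_ _ gfq _] := fg q ltac:(lia).
pose P j := (f q < j) && (q < g j).
have exP : exists j, P j by exists (f q.+1); rewrite /P fq gfq1 ltnSn.
have [[//|j] /andP[fqj qg] min] := ex_minnP exP.
have jle : j.+1 <= f q.+1 by apply: min; rewrite /P fq gfq1 ltnSn.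
exists j; apply/and4P; split=> //; try lia.
rewrite qg andbT leqNgt; apply/negP => qgj.
have fqj' : f q <> j by move=> e; move: gfq; rewrite e; lia.
by have := min j; rewrite /P qgj; lia.
Qed.

(* [y] is the largest value taken on [0, p]; pigeonhole gives [p <= y]. *)
Lemma essential_of_record n f g p : perm_pair n f g -> p.+1 < n ->
  (forall x, x <= p -> f x < f p.+1) ->
  exists2 y, essential n f g p y & p <= y /\ exists2 x, x <= p & y = f x.
Proof.
move=> fg pn rec; have [fp1 _ gfp1 _] := fg _ pn.
pose y := \max_(x < p.+1) f x.
have yge x : x <= p -> f x <= y.
  by rewrite -ltnS => xp; exact: (leq_bigmax (Ordinal xp)).
have [[x /= xp] /esym yE] : {x : 'I_p.+1 | y = f x} by apply: eq_bigmax; rewrite card_ord.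
have [_ _ gfx _] := fg x ltac:(lia).
have yn : y.+1 < n by have := rec x xp; lia.
have [_ gy1 _ fgy1] := fg _ yn.
exists y; last first.
  split; last by exists x.
  have fin (i : 'I_p.+1) : f i < y.+1 by rewrite ltnS yge // -ltnS.
  have := leq_card (fun i : 'I_p.+1 => Ordinal (fin i)); rewrite !card_ord ltnS; apply.
  move=> i j /(congr1 val) /= /(congr1 g).
  have [_ _ -> _] := fg i ltac:(have := ltn_ord i; lia).
  have [_ _ -> _] := fg j ltac:(have := ltn_ord j; lia).
  exact: val_inj.
apply/and4P; split=> //.
- by rewrite yge //= -yE; apply: rec.
- rewrite -{1}yE gfx -ltnS xp /= ltnNge; apply/negP => gp.
  by have := yge _ gp; rewrite fgy1 ltnn.
Qed.

(** * Inserting the largest value before a decreasing tail *)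

Section DecreasingInsertion.

Variables (n k : nat) (f' g' f g : nat -> nat).
Hypotheses (fg' : perm_pair n f' g') (fg : perm_pair n.+1 f g).
Hypothesis ins : inserted n k f' g' f g.
Hypothesis dec : forall q, k <= q -> q.+1 < n -> f' q.+1 < f' q.

Lemma dec_leq p q : k <= p -> p <= q -> q < n -> f' q + (q - p) <= f' p.
Proof.
move=> kp; elim: q => [|q IH]; first by rewrite leqn0 => /eqP->; lia.
rewrite leq_eqVlt => /predU1P[->|]; first by lia.
by rewrite ltnS => pq qn; have := IH pq ltac:(lia); have := dec (leq_trans kp pq) qn; lia.
Qed.

(** For [k < n], the value [f n] ends a strictly decreasing run of [n - k] values below [n]. *)
Lemma dec_inserted_last : f n <= k.
Proof.
have [kn fk gn fE gE] := ins.
case: (ltngtP k n) kn => // [kn|kn] _; last by rewrite -{1}kn fk kn.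
have := dec_leq (leqnn k) (ltac:(lia) : k <= n.-1) ltac:(lia).
have [fk' _ _ _] := fg' (ltac:(lia) : k < n).
have <- : f n = f' n.-1 by rewrite -(inserted_ge ins) ?prednK; lia.
by lia.
Qed.

(** Converse of [tperm_below_inserted]; the decreasing tail supplies new witnesses when the old ones
    depend on the insertion. *)
Lemma dec_tperm_below a b :
  b < n -> tperm_below f g a b -> tperm_below f' g' a b.
Proof.
have [kn fk gn fE gE] := ins.
move=> bn /and3P[ab /reachesP[p pa bfp] /reachesP[v va bgv]].
apply/and3P; split=> //; apply/reachesP.
  case: (ltngtP p k) => [pk|kp|pk].
  - by exists p => //; rewrite -(inserted_lt ins).
  - case: p pa bfp kp => // p pa bfp kp; exists p; first by lia.
    by rewrite -(inserted_ge ins) //; lia.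
  (* The value [n] at [k] is absent from [f'], so [n.-1] replaces it. Were it located after [a], the
     tail would have a value above [n.-1] at [a]. *)
  have [_ xn _ fx] := fg' (ltac:(lia) : n.-1 < n).
  case: (leqP (g' n.-1) a) => [xa|ax]; first by exists (g' n.-1) => //; lia.
  have := dec_leq (ltac:(lia) : k <= a) (ltnW ax) xn.
  by have [? _ _ _] := fg' (ltac:(lia) : a < n); lia.
rewrite gE in bgv; last by lia.
case: (leqP b (g' v)) => [bv|vb]; first by exists v.
(* Only the shift brought [v] to position [b]: in [f'] it sits at [b - 1], and the next tail entry
   [f' b] is smaller than [v]. *)
have [_ _ _ fgv] := fg' (ltac:(lia) : v < n).
have [eb kb] : (g' v).+1 = b /\ k <= g' v by move: bgv; rewrite /bump; lia.
exists (f' b); last by have [_ _ -> _] := fg' bn.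
by rewrite -eb; have := dec kb ltac:(lia); lia.
Qed.

Lemma dec_smooth : smooth_pair n f' g' -> smooth_pair n.+1 f g.
Proof.
rewrite /smooth_pair (inv_count_inserted fg' ins) (tperm_count_inserted_split ins fg).
rewrite (maxn_idPl dec_inserted_last) => ->; congr (_ + _).
apply: eq_bigr => a _; apply: eq_bigr => b _; congr nat_of_bool.
by apply/idP/idP; [apply: (tperm_below_inserted ins) | apply: dec_tperm_below].
Qed.

(** Essential points lie at ascents, and none exist from [k] on. In rows [i < k] the shift does not
    affect comparisons with [i], and only row [k - 1] sees the value [n]. *)
Lemma dec_essential i j : essential n.+1 f g i j =
  essential n f' g' i j || [&& i.+1 == k, j.+1 == n & g' j <= i].
Proof.
have [kn fk gn fE gE] := ins.
case: (ltnP i k) => [ik|ki]; last first.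
  rewrite [X in _ || X]andbC -andbA [in RHS]/essential.
  have -> : (i.+1 == k) = false by lia.
  rewrite !andbF orbF; apply/idP/idP => /and4P[i1 j1 fi gj]; exfalso; last first.
    by have := dec ki i1; lia.
  have : f i.+1 < f i; last by lia.
  rewrite (inserted_ge ins) //; move: ki; rewrite leq_eqVlt => /predU1P[ki|ki].
    by rewrite -ki fk ki; have [] := fg' (ltac:(lia) : i < n).
  case: i ki i1 {fi gj} => // i ki i1; rewrite (inserted_ge ins); try lia.
  by apply: dec; lia.
rewrite /essential !ltnS (inserted_lt ins ik).
case: (ltnP j n) => jn; last by rewrite !andbF [_.+1 == n]gtn_eqF ?andbF //; lia.
rewrite gE //; have bumpi x : (bump k x <= i) = (x <= i) by rewrite /bump; lia.
have bump_gt x : (i < bump k x) = (i < x) by rewrite /bump; lia.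
rewrite bumpi; have [_ gj _ fgj] := fg' jn.
case: (ltngtP i.+1 k) ik => // [ik|ik] _.
  rewrite (inserted_lt ins ik) orbF; case: (ltngtP j.+1 n) jn => // [jn|jn] _.
    rewrite gE // bump_gt.
    by have -> : i.+1 < n = (i < n) by lia.
  have [fi _ _ _] := fg' (ltac:(lia) : i.+1 < n).
  by lia.
have -> : f i.+1 = n by rewrite ik.
rewrite ik; case: (ltngtP j.+1 n) jn => // [jn|jn] _; last first.
  rewrite jn gn andbF /=.
  have [fi _ _ _] := fg' (ltac:(lia) : i < n).
  by lia.
rewrite -ik orbF gE // bump_gt.
have [_ gj1 _ fgj1] := fg' jn.
apply/idP/idP => /and4P[]; last by lia.
move=> i1 _ /andP[fij _] /andP[gji igj].
have i2 : k < n by lia.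
(* The value [j.+1] lies in the tail, whose first entry is its largest; hence [j < f' k]. *)
have := dec_leq (leqnn k) (ltac:(lia) : k <= g' j.+1) gj1.
by rewrite fgj1 ik; lia.
Qed.

Lemma dec_essential_lt i j : essential n f' g' i j -> i < k.
Proof. by case/and4P=> i1 _ fi _; case: ltnP => // /dec/(_ i1); lia. Qed.

Lemma dec_by_inclusions : by_inclusions n f' g' -> by_inclusions n.+1 f g.
Proof.
have [kn fk gn fE gE] := ins.
move=> inc i j; rewrite dec_essential => /orP[E|/and3P[/eqP ik /eqP jn gj]].
  have ik := dec_essential_lt E; have [i1 j1 _ _] := and4P E.
  have [up down] := inc _ _ E; split=> [ij p pi|ji v vj].
    by rewrite (inserted_lt ins); [apply: up | lia].
  by rewrite gE; [have := down ji v vj; rewrite /bump|]; lia.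
split=> [ij p pi|ji v vj].
  by rewrite (inserted_lt ins); [have [] := fg' (ltac:(lia) : p < n)|]; lia.
by have [] := fg' (ltac:(lia) : v < n); rewrite gE /bump; lia.
Qed.

Lemma dec_admissible : by_inclusions n f' g' ->
  admissible_rel (essential n f' g') -> admissible_rel (essential n.+1 f g).
Proof.
move=> inc adE.
have old_new i1 j1 i2 j2 : essential n f' g' i1 j1 ->
    [&& i2.+1 == k, j2.+1 == n & g' j2 <= i2] ->
    [/\ i1 <= i2, j1 <= j2, maxn i1 j1 < maxn i2 j2 & minn i1 j1 < minn i2 j2].
  move=> E1 /and3P[/eqP ik /eqP jn gj]; have ik1 := dec_essential_lt E1.
  have [i1n j1n _ _] := and4P E1; have [up _] := inc _ _ E1.
  have [_ _ _ fgj] := fg' (ltac:(lia) : j2 < n).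
  (* An old point in row [k - 1] with [i1 <= j1] would be an inclusion bounding the value [n.-1], at
     position [g' j2], by [j1 < n.-1]. This makes the minimum strictly increase. *)
  have : i1 = i2 -> j1 < i1.
    move=> e; case: ltnP => // /up/(_ (g' j2)); rewrite fgj; lia.
  have [kn _ _ _ _] := ins.
  by split; lia.
move=> i1 j1 i2 j2; rewrite !dec_essential => /orP[E1|E1] /orP[E2|E2] ne le12.
- exact: adE.
- exact: old_new.
- by have [] := old_new _ _ _ _ E2 E1; lia.
- by case: ne; move: E1 E2 => /and3P[? ? _] /and3P[? ? _]; congr pair; lia.
Qed.

End DecreasingInsertion.

(** * From smoothness to inclusions and admissibility *)

(** An ascent at [q >= k] gives an essential point [(q, j)] with [j < q]. A second point [(p, y)]
    with [j <= p <= y] and [p < q] then contradicts admissibility. *)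
Lemma smooth_dec n k f' g' f g :
  perm_pair n f' g' -> perm_pair n.+1 f g -> inserted n k f' g' f g ->
  f n <= k -> by_inclusions n f' g' -> admissible_rel (essential n f' g') ->
  (forall a b, a < n -> b < n -> tperm_below f g a b -> tperm_below f' g' a b) ->
  forall q, k <= q -> q.+1 < n -> f' q.+1 < f' q.
Proof.
move=> fg' fg ins fnk inc adE noextra q kq qn.
have [kn fk gn fE gE] := ins.
rewrite ltnNge leq_eqVlt; apply/negP => /predU1P[e|asc].
  have [_ _ e1 _] := fg' _ qn; have [_ _ e2 _] := fg' q ltac:(lia).
  by move: e1; rewrite -e e2; lia.
have [_ xn _ fx] := fg' n.-1 ltac:(lia).
(* The transposition [(k n.-1)] is below [f], by the values [n] at [k] and [f n <= k] at [n]; being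
   below [f'], it forces [n.-1] to occur by [k]. *)
have xk : g' n.-1 <= k.
  case: (leqP n.-1 k) => [?|kn1]; first by lia.
  have : tperm_below f' g' k n.-1.
    apply: noextra; try lia.
    apply/and3P; split=> //; apply/reachesP; first by exists k; lia.
    by exists (f n) => //; have [_ _ -> _] := fg n (ltnSn n); lia.
  case/and3P=> _ /reachesP[p pk] fp _.
  have [fpn _ gfp _] := fg' p ltac:(lia).
  by have <- : f' p = n.-1 by [lia]; rewrite gfp.
have [j E] := essential_of_ascent fg' qn asc.
have [up down] := inc _ _ E; have [_ jn fj gj] := and4P E.
have jq : j < q.
  by rewrite ltnNge; apply/negP => /up/(_ (g' n.-1)); rewrite fx; lia.
(* Otherwise [(j q.+1)] is below [f], as the value [f' q <= j] has moved to [q.+1]; but it is not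
   below [f'], by the inclusion at [(q, j)]. *)
have fjq p : p <= j -> f p <= q.
  move=> pj; rewrite leqNgt; apply/negP => qp.
  have : tperm_below f' g' j q.+1.
    apply: noextra; try lia.
    apply/and3P; split; first by lia.
      by apply/reachesP; exists p.
    apply/reachesP; exists (f' q); first by lia.
    have [fqn _ gfq _] := fg' q ltac:(lia).
    by rewrite gE // gfq /bump; lia.
  by case/and3P=> _ _ /reachesP[v vj]; have := down (ltnW jq) v vj; lia.
have jk : j < k by rewrite ltnNge; apply/negP => /fjq; lia.
have fjq' p : p <= j -> f' p <= q.
  by move=> pj; rewrite -(inserted_lt ins); [apply: fjq | lia].
(* The first position whose value exceeds [q] is a record, lying after [j] and no later than [k]. *)
have exP : exists x, q < f' x by exists (g' n.-1); lia.
have [[|p] qp min] := ex_minnP exP; first by have := fjq' 0 isT; lia.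
have px := min (g' n.-1) ltac:(lia).
have fpq x : x <= p -> f' x <= q.
  by move=> xp; rewrite leqNgt; apply/negP => /min; lia.
have jp : j <= p by rewrite leqNgt; apply/negP => /fjq'; lia.
have [||y E' [py _]] := essential_of_record (p := p) fg'; first by lia.
  by move=> x /fpq; lia.
have ne : (q, j) <> (p, y) by case; lia.
by have [] := adE _ _ _ _ E E' ne; lia.
Qed.

Lemma smooth_pair_essential n f g : perm_pair n f g -> smooth_pair n f g ->
  by_inclusions n f g /\ admissible_rel (essential n f g).
Proof.
elim: n f g => [|n IH] f g fg sm; first by split=> i; rewrite /by_inclusions /essential.
wlog fngn : f g fg sm / f n <= g n.
  move=> WL; case: (leqP (f n) (g n)) => [|/ltnW gnfn]; first exact: WL.
  have [inc adE] := WL _ _ (perm_pairC fg) (smooth_pairC fg sm) gnfn.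
  split; first exact: by_inclusionsC.
  move=> i1 j1 i2 j2; rewrite -!(essentialC n.+1 f g).
  exact: (admissible_relC adE).
have [f' [g' [fg' ins]]] := deleted_perm fg.
have [sm' noextra] := smooth_deleted fg' fg ins fngn sm.
have [inc adE] := IH _ _ fg' sm'.
have dec := smooth_dec fg' fg ins fngn inc adE noextra.
split; first exact: (dec_by_inclusions fg' ins dec).
exact: (dec_admissible fg' ins dec).
Qed.

(** * Realizing an admissible set *)

(** A point of greatest [minn i j] works: admissibility compares every other point with it. *)
Lemma last_point n (E : nat -> nat -> bool) :
  (forall i j, E i j -> i < n /\ j < n) -> admissible_rel E ->
  (forall i j, ~~ E i j) \/
  exists i j, E i j /\ forall i' j', E i' j' ->
    [/\ i' <= i, j' <= j & (i', j') <> (i, j) ->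
       minn i' j' < minn i j /\ maxn i' j' < maxn i j].
Proof.
move=> En adE.
pose P (m : nat) := [exists i : 'I_n, exists j : 'I_n, E i j && (minn i j == m)].
have PE i j : E i j -> P (minn i j).
  move=> Eij; have [ltin ltjn] := En _ _ Eij.
  by apply/existsP; exists (Ordinal ltin); apply/existsP; exists (Ordinal ltjn) => /=; rewrite Eij /=.
case: (boolP [exists m : 'I_n, P m]) => [/existsP[m0 Pm0]|noP]; last first.
  left=> i j; apply/negP => Eij; case/existsP: noP.
  have ltm : minn i j < n by have := En _ _ Eij; lia.
  by exists (Ordinal ltm); exact: PE.
have Ple m : P m -> m <= n.
  by case/existsP=> i /existsP[j /andP[_ /eqP<-]]; have := ltn_ord i; lia.
have exP : exists m, P m by exists (m0 : nat).
have [m /existsP[i /existsP[j /andP[Eij /eqP ijm]]] max] := ex_maxnP exP Ple.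
right; exists (i : nat), (j : nat); split=> // i' j' E'.
have [[-> ->]|ne] := (i', j') =P (i : nat, j : nat); first by split.
have [|? ? ? ?] := adE _ _ _ _ E' Eij ne; last by split.
by rewrite ijm; apply/max/PE.
Qed.

Lemma admissible_realized n (E : nat -> nat -> bool) :
  (forall i j, E i j -> i.+1 < n /\ j.+1 < n) -> admissible_rel E ->
  exists f g, [/\ perm_pair n f g, smooth_pair n f g, by_inclusions n f g
    & forall i j, essential n f g i j = E i j].
Proof.
elim: n E => [|n IH] E En adE.
  exists id, id; split=> //; first by rewrite /smooth_pair /inv_count /tperm_count !big_ord0.
  by move=> i j; apply/esym/negP => /En[].
(* The last point is [(k.-1, y)] with [k.-1 <= y], up to exchanging coordinates; [k = 0] encodes the
   empty set. The value [n] goes to position [k]. *)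
suff WL (E0 : nat -> nat -> bool) k : (forall i j, E0 i j -> i < n /\ j < n) -> admissible_rel E0 ->
    k <= n -> (forall i j, E0 i j -> i < k) ->
    (0 < k -> exists2 y, E0 k.-1 y & k.-1 <= y) ->
    exists f g, [/\ perm_pair n.+1 f g, smooth_pair n.+1 f g, by_inclusions n.+1 f g
      & forall i j, essential n.+1 f g i j = E0 i j].
  have En' i j : E i j -> i < n /\ j < n by move=> /En[]; lia.
  have [E0|[i [j [Eij last]]]] := last_point En' adE.
    by apply: (WL E 0) => // i j Eij; have := E0 i j; rewrite Eij.
  have [ltin ltjn] := En' _ _ Eij.
  case: (leqP i j) => [ij|/ltnW ji].
    apply: (WL E i.+1) => // [i' j' /last[]|_]; first by lia.
    by exists j.
  have [|||||f [g [fg sm inc ess]]] := WL (fun i j => E j i) j.+1.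
  - by move=> i' j' /En'[].
  - exact: admissible_relC.
  - by [].
  - by move=> i' j' /last[].
  - by move=> _; exists i.
  exists g, f; split.
  - exact: perm_pairC.
  - exact: smooth_pairC.
  - exact: by_inclusionsC.
  - by move=> i' j'; rewrite essentialC ess.
move=> {E En adE}En adE kn Ek Elast; rename E0 into E.
have [||f' [g' [fg' sm' inc' ess']]] := IH (fun i j => [&& i.+1 < n, j.+1 < n & E i j]).
- by move=> i j /and3P[].
- by move=> i1 j1 i2 j2 /and3P[_ _ E1] /and3P[_ _ E2]; exact: adE.
(* An ascent from [k] on would give a point of [E] in a row beyond the last one. *)
have dec q : k <= q -> q.+1 < n -> f' q.+1 < f' q.
  move=> kq qn; rewrite ltnNge leq_eqVlt; apply/negP => /predU1P[e|asc].
    have [_ _ e1 _] := fg' _ qn; have [_ _ e2 _] := fg' q ltac:(lia).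
    by move: e1; rewrite -e e2; lia.
  have [j] := essential_of_ascent fg' qn asc.
  by rewrite ess' => /and3P[_ _ /Ek]; lia.
have [f [g [fg ins]]] := insert_perm kn fg'.
exists f, g; split=> //.
- exact: (dec_smooth fg' fg ins dec).
- exact: (dec_by_inclusions fg' ins dec).
move=> i j; rewrite (dec_essential fg' ins dec) ess'.
(* If [n.-1] came later, the record there would give a second point of [E] in row [k.-1] with
   minimum [k.-1], against strictness of the minima. *)
have new_point : E k.-1 n.-1 -> 0 < k -> g' n.-1 <= k.-1.
  move=> Ekn k0; rewrite leqNgt; apply/negP => kg.
  have [_ xn _ fx] := fg' n.-1 ltac:(lia).
  have gE : g' n.-1 = (g' n.-1).-1.+1 by lia.
  have [||y Ey [py _]] := essential_of_record (p := (g' n.-1).-1) fg'; first by lia.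
    move=> x xp; rewrite -gE fx; have [? _ gfx _] := fg' x ltac:(lia).
    suff : f' x <> n.-1 by lia.
    by move=> e; move: gfx; rewrite e; lia.
  move: Ey; rewrite ess' => /and3P[_ yn Ey].
  have pk : (g' n.-1).-1 = k.-1 by have := Ek _ _ Ey; lia.
  rewrite pk in Ey py.
  have ne : (k.-1, y) <> (k.-1, n.-1) by case; lia.
  by have [] := adE _ _ _ _ Ey Ekn ne; lia.
apply/orP/idP => [[/and3P[]//|/and3P[/eqP ik /eqP jn gj]]|Eij].
  have [y Ey ky] := Elast ltac:(lia).
  have [_ yn] := En _ _ Ey.
  have ik' : k.-1 = i by lia.
  case: (ltngtP y.+1 n) yn => // [yn|yn] _; last first.
    by have <- : y = j by [lia]; rewrite -ik'.
  (* If the last point is already present in [f'], its inclusion forbids the value [n.-1] at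
     positions up to [i], so no unwanted point arises. *)
  have : essential n f' g' i y by rewrite ess' yn -ik' Ey; lia.
  case/inc' => up _.
  have [_ _ _ fgj] := fg' j ltac:(lia).
  by have := up ltac:(lia) (g' j) gj; rewrite fgj; lia.
have ik := Ek _ _ Eij; have [ltin ltjn] := En _ _ Eij.
case: (boolP ((i.+1 < n) && (j.+1 < n))) => [/andP[-> ->]|bd]; first by left; rewrite Eij.
(* A point with a coordinate [n.-1] must be the last one, by strictness of the maxima or of the
   minima. *)
right; have [y Ey ky] := Elast ltac:(lia); have [_ yn] := En _ _ Ey.
have [e|ne] := (i, j) =P (k.-1, y).
  case: e => ik' jy; have jn : j = n.-1 by lia.
  by rewrite jn ik'; rewrite ik' jn in Eij; have := new_point Eij; lia.
case: (leqP (minn i j) (minn k.-1 y)) => [le|/ltnW le].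
  by have [] := adE _ _ _ _ Eij Ey ne le; lia.
by have [] := adE _ _ _ _ Ey Eij (fun e => ne (esym e)) le; lia.
Qed.

(** * Rank functions and injectivity *)

(** Here [i] and [j] are sizes, from 0 to [n], so that empty and full corners are included. *)
Definition rank (f : nat -> nat) (i j : nat) : nat := \sum_(p < i) (f p < j).

(** Both sides count the pairs [(p, v)] with [f p = v], [p < i] and [v < j]. *)
Lemma rankC n f g i j : perm_pair n f g -> i <= n -> j <= n ->
  rank f i j = rank g j i.
Proof.
move=> fg ltin ltjn.
have count m x : (x < m) = \sum_(v < m) (x == v) :> nat.
  elim: m => [|m IH]; first by rewrite big_ord0.
  by rewrite big_ord_recr /= -IH; lia.
rewrite /rank; under eq_bigr do rewrite count.
under [RHS]eq_bigr do rewrite count.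
rewrite exchange_big /=; apply: eq_bigr => v _; apply: eq_bigr => p _.
have [_ _ gfp _] := fg p ltac:(have := ltn_ord p; lia).
have [_ _ _ fgv] := fg v ltac:(have := ltn_ord v; lia).
by congr nat_of_bool; apply/eqP/eqP => [<-|<-].
Qed.

Lemma rankS f i j : rank f i.+1 j = rank f i j + (f i < j).
Proof. by rewrite /rank big_ord_recr. Qed.

Lemma rank_full f i j : (forall p, p < i -> f p < j) -> rank f i j = i.
Proof.
elim: i => [|i IH] fj; first by rewrite /rank big_ord0.
by rewrite rankS IH => [|p pi]; rewrite fj //; lia.
Qed.

Lemma rank_le f i j : rank f i j <= i.
Proof. by elim: i => [|i IH]; rewrite ?rankS /rank ?big_ord0 //; move: IH; rewrite /rank; lia. Qed.

Lemma rankSr n f g i j : perm_pair n f g -> i <= n -> j < n ->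
  rank f i j.+1 = rank f i j + (g j < i).
Proof. by move=> fg ltin ltjn; rewrite !(rankC fg) ?rankS // ltnW. Qed.

Section RankComparison.

Variables (n : nat) (f g f2 g2 : nat -> nat).
Hypotheses (fg : perm_pair n f g) (fg2 : perm_pair n f2 g2).
Hypothesis ess_incl : forall i j, essential n f g i j ->
  (i <= j -> forall p, p <= i -> f2 p <= j) /\
  (j <= i -> forall v, v <= j -> g2 v <= i).

(* Rank conditions propagate from the essential set: at any other point one of the four
   neighbours imposes a stronger condition and has a smaller value of [i + j - 2 rank f i j]. *)
Lemma rank_mono i j : i <= n -> j <= n -> rank f i j <= rank f2 i j.
Proof.
have [d lt_d] : exists d, i + j < (rank f i j).*2 + d by exists (i + j).+1; lia.
elim: d i j lt_d => [|d IH] i j lt_d ltin ltjn;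
  have r1 := rank_le f i j; have := rank_le g j i; rewrite -(rankC fg) // => r2.
  by lia.
case: (ltngtP i n) ltin => // [ltin|->] _; last first.
  rewrite [leqRHS](rankC fg2) // [leqRHS]rank_full => [|v vj].
    by rewrite (rankC fg) ?rank_le.
  by have [] := fg2 (ltac:(lia) : v < n).
case: (ltngtP j n) ltjn => // [ltjn|->] _; last first.
  rewrite [leqRHS]rank_full ?rank_le // => v vj.
  by have [] := fg2 (ltac:(lia) : v < n).
case: i => [|i] in lt_d ltin r1 r2 *; first by rewrite /rank !big_ord0.
case: j => [|j] in lt_d ltjn r1 r2 *; first by lia.
case: (leqP j.+1 (f i)) => [jfi|fij].
  have rE : rank f i.+1 j.+1 = rank f i j.+1 by rewrite rankS; lia.
  have := IH i j.+1; rewrite -rE (rankS f2); lia.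
case: (leqP (f i.+1) j) => [fij1|jfi1].
  by have := IH i.+2 j.+1; rewrite !(rankS _ i.+1); lia.
case: (leqP i.+1 (g j)) => [igj|gji].
  have rE : rank f i.+1 j.+1 = rank f i.+1 j by rewrite (rankSr fg); lia.
  have := IH i.+1 j; rewrite -rE (rankSr fg2); lia.
case: (leqP (g j.+1) i) => [gji1|igj1].
  by have := IH i.+1 j.+2; rewrite (rankSr fg) ?(rankSr fg2) //; lia.
have [|up down] := ess_incl (i := i) (j := j).
  by apply/and4P; split=> //; apply/andP; split.
case: (leqP i j) => [ij|/ltnW ji].
  by rewrite [leqRHS]rank_full // => p; rewrite !ltnS; apply: up.
by rewrite (rankC fg2 (ltnW ltin) (ltnW ltjn)) [leqRHS]rank_full // => v; rewrite !ltnS; apply: down.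
Qed.

End RankComparison.

(** Each permutation satisfies the inclusions of the other, so the ranks agree by two inequalities;
    their differences in [i] determine whether [f p < j], hence [f p]. *)
Lemma essential_inj n f g f2 g2 : perm_pair n f g -> perm_pair n f2 g2 ->
  by_inclusions n f g -> by_inclusions n f2 g2 ->
  (forall i j, essential n f g i j = essential n f2 g2 i j) ->
  forall p, p < n -> f p = f2 p.
Proof.
move=> fg fg2 inc inc2 ess p pn.
have rankE i j : i <= n -> j <= n -> rank f i j = rank f2 i j.
  move=> ltin ltjn; apply/eqP; rewrite eqn_leq (rank_mono fg fg2) //=; last first.
    by move=> i' j'; rewrite ess; apply: inc2.
  by rewrite (rank_mono fg2 fg) // => i' j'; rewrite -ess; apply: inc.
have [fp _ _ _] := fg p pn; have [f2p _ _ _] := fg2 p pn.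
have ltE j : j <= n -> (f p < j) = (f2 p < j).
  by move=> jn; have := rankE p.+1 j pn jn; have := rankE p j (ltnW pn) jn; rewrite !rankS; lia.
by have := ltE _ fp; have := ltE _ f2p; lia.
Qed.

(** * Translation to ['S_n] and the Bruhat order *)

Section Translation.

Variable n : nat.
Implicit Types s t : 'S_n.+1.

Definition nat_perm s (i : nat) : nat := s (inord i).

Local Notation "s ^f" := (nat_perm s) (at level 2, format "s ^f").

Lemma nat_permE s (i : 'I_n.+1) : s^f i = s i.
Proof. by rewrite /nat_perm inord_val. Qed.

Lemma perm_pair_nat_perm s : perm_pair n.+1 s^f (s^-1)%g^f.
Proof.
move=> i ltin; split; try exact: ltn_ord.
all: by rewrite /nat_perm inord_val (permK, permKV) inordK.
Qed.

Lemma perm_of_fun f g : perm_pair n.+1 f g ->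
  exists s, (forall i, i < n.+1 -> s^f i = f i) /\ (forall i, i < n.+1 -> (s^-1)%g^f i = g i).
Proof.
move=> fg.
have fi (i : 'I_n.+1) : f i < n.+1 by have [] := fg i (ltn_ord i).
have injf : injective (fun i => Ordinal (fi i)).
  move=> i j /(congr1 val) /= /(congr1 g).
  have [_ _ -> _] := fg i (ltn_ord i); have [_ _ -> _] := fg j (ltn_ord j).
  exact: val_inj.
have sf i : i < n.+1 -> (perm injf)^f i = f i.
  by move=> ltin; rewrite /nat_perm permE /= inordK.
exists (perm injf); split=> // i ltin.
have [_ gi _ fgi] := fg i ltin.
have [_ hi _ shi] := perm_pair_nat_perm (perm injf) ltin.
have [_ _ <- _] := fg _ hi.
by rewrite -(sf _ hi) shi.
Qed.

Lemma nat_perm_inj s t : (forall i, i < n.+1 -> s^f i = t^f i) -> s = t.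
Proof. by move=> st; apply/permP => i; apply: val_inj; rewrite /= -!nat_permE st. Qed.

Lemma Eset_essential s (i j : 'I_n) :
  ((i, j) \in Eset s) = essential n.+1 s^f (s^-1)%g^f i j.
Proof.
rewrite inE /= /essential !ltnS !ltn_ord /=.
have incl (k : 'I_n) : ord_incl (n := n.+1) k = inord k.
  by apply: val_inj; rewrite /= inordK // ltnS ltnW.
have shift (k : 'I_n) : ord_shift (n := n.+1) k = inord k.+1.
  by apply: val_inj; rewrite /= inordK // ltnS.
by rewrite /nat_perm -!incl -!shift.
Qed.

Lemma inversions_count s : #|inversions s| = inv_count n.+1 s^f.
Proof.
rewrite -sum1dep_card /inv_count pair_big big_mkcond /=; apply: eq_bigr => -[i j] _ /=.
by rewrite !nat_permE; case: (_ && _).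
Qed.

Lemma card_initial (i : 'I_n.+1) : #|initial i| = i.+1.
Proof.
have := @big_ord_widen _ 0 addn _ n.+1 (fun=> 1) (ltn_ord i).
by rewrite big_const_ord iter_addn_0 mul1n => ->; rewrite sum1dep_card.
Qed.

Lemma imset_initial_sub s (i j : 'I_n.+1) :
  (s @: initial i \subset initial j) = ~~ reaches s^f i j.+1.
Proof.
apply/subsetP/idP => [sub|nr x /imsetP[k ki ->]].
  apply/reachesP => -[p pi jp]; have pn : p < n.+1 := leq_ltn_trans pi (ltn_ord i).
  have := sub (s (Ordinal pn)) (imset_f _ _); rewrite !inE /= => /(_ pi).
  by rewrite -nat_permE /= leqNgt jp.
rewrite !inE in ki *; rewrite leqNgt; apply: contra nr => jk.
by apply/reachesP; exists (k : nat); rewrite // nat_permE.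
Qed.

(** The number compared in [bruhat_le]: the rank of [nat_perm s] at [i.+1] and [j.+1]. *)
Definition corner s (i j : 'I_n.+1) : nat := #|(s @: initial i) :&: initial j|.

Lemma cornerC s i j : corner s i j = corner (s^-1)%g j i.
Proof.
rewrite /corner -(card_imset (mem (s @: initial i :&: initial j)) (perm_inj (s := (s^-1)%g))).
rewrite imsetI; last by move=> x y _ _; apply: perm_inj.
rewrite setIC; congr #|pred_of_set (_ :&: _)|.
by rewrite -imset_comp (eq_imset _ (permK s)) imset_id.
Qed.

Lemma corner_le s i j : corner s i j <= i.+1.
Proof.
rewrite -card_initial -(card_imset (mem (initial i)) (perm_inj (s := s))).
exact/subset_leq_card/subsetIl.
Qed.

(** The corner has its maximal size [i.+1] exactly when the image of [initial i] lies in
    [initial j]. *)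
Lemma corner_lt s i j : (corner s i j <= i) = reaches s^f i j.+1.
Proof.
rewrite -[RHS]negbK -imset_initial_sub -ltnS ltn_neqAle corner_le andbT.
congr (~~ _); rewrite -card_initial -(card_imset (mem (initial i)) (perm_inj (s := s))).
have [_ ->] := subset_leqif_cards (subsetIl (s @: initial i) (initial j)).
exact/eqP/setIidPl.
Qed.

Lemma bruhat_le_corner s t :
  bruhat_le t s = [forall i, forall j, corner s i j <= corner t i j].
Proof. by []. Qed.

Lemma tperm_lt_id (a b x : 'I_n.+1) : x != a -> x < b -> tperm a b x = x.
Proof. by move=> xa xb; rewrite tpermD // eq_sym // -val_eqE ltn_eqF. Qed.

(** For [i <= j] the corner of [(a b)] has full size [i.+1], unless [a <= i] and [j < b]. There only
    [a] is lost, and the witness of [reaches] costs [s] an element too. *)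
Lemma corner_tperm_ge s (a b i j : 'I_n.+1) : a < b ->
  reaches s^f a b -> i <= j -> corner s i j <= corner (tperm a b) i j.
Proof.
move=> ab /reachesP[k ka bk] ij; case: (boolP ((a <= i) && (j < b))) => [/andP[ai jb]|out].
  have le1 : corner s i j <= i by rewrite corner_lt; apply/reachesP; exists k; lia.
  apply: leq_trans le1 _; rewrite -ltnS -card_initial (cardsD1 a) inE ai add1n ltnS.
  apply: subset_leq_card; apply/subsetP => x; rewrite !inE => /andP[xa xi].
  rewrite (leq_trans xi ij) andbT; apply/imsetP; exists x; first by rewrite inE.
  by rewrite tperm_lt_id //; lia.
apply: leq_trans (corner_le _ _ _) _; rewrite ltnNge corner_lt; apply/reachesP => -[p pi].
have pn : p < n.+1 := leq_ltn_trans pi (ltn_ord i).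
rewrite -[p]/(val (Ordinal pn)) nat_permE.
by case: tpermP => [/(congr1 val)|/(congr1 val)|_ _] /=; lia.
Qed.

Lemma corner_tperm_reaches s (a b c : 'I_n.+1) : c.+1 = b ->
  corner s a c <= corner (tperm a b) a c -> reaches s^f a b.
Proof.
move=> cb le; rewrite -cb -corner_lt (leq_trans le) // corner_lt cb.
by apply/reachesP; exists a => //; rewrite nat_permE tpermL.
Qed.

(** The corners [(a, b - 1)] and [(b - 1, a)] already give the two [reaches] conditions; these imply
    all others, on either side of the diagonal, since [(a b)] is its own inverse. *)
Lemma bruhat_le_tperm s (a b : 'I_n.+1) : a < b ->
  bruhat_le (tperm a b) s = tperm_below s^f (s^-1)%g^f a b.
Proof.
move=> ab; rewrite bruhat_le_corner /tperm_below ab /=.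
apply/forallP/andP => [le|[up down] i].
  have bn : b.-1 < n.+1 by have := ltn_ord b; lia.
  pose c := Ordinal bn; have cb : c.+1 = b by rewrite /=; lia.
  have leC i j := forallP (le i) j.
  split; first exact: corner_tperm_reaches cb (leC _ _).
  apply: (corner_tperm_reaches cb); have := leC c a.
  by rewrite !(cornerC _ c) tpermV.
apply/forallP => j; case: (leqP i j) => [ij|/ltnW ji].
  exact: corner_tperm_ge.
by rewrite cornerC [leqRHS]cornerC tpermV corner_tperm_ge.
Qed.

Lemma transpositions_count s :
  #|[set t : 'S_n.+1 | is_transposition t && bruhat_le t s]| =
  tperm_count n.+1 s^f (s^-1)%g^f.
Proof.
pose D := [set p : 'I_n.+1 * 'I_n.+1 | tperm_below s^f (s^-1)%g^f p.1 p.2].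
have -> : tperm_count n.+1 s^f (s^-1)%g^f = #|D|.
  rewrite -sum1dep_card /tperm_count pair_big [RHS]big_mkcond /=.
  by apply: eq_bigr => -[i j] _ /=; case: tperm_below.
have <- : [set tperm p.1 p.2 | p in D] = [set t : 'S_n.+1 | is_transposition t && bruhat_le t s].
  apply/setP => t; rewrite inE; apply/imsetP/andP => [[[a b]]|[/existsP[a /existsP[b /andP[ab /eqP->]]] le]].
    rewrite inE /= => below ->; have /andP[ab _] := below.
    split; last by rewrite bruhat_le_tperm.
    by apply/existsP; exists a; apply/existsP; exists b; rewrite eqxx andbT -val_eqE ltn_eqF.
  move: ab; rewrite -val_eqE neq_ltn => /orP[ab|ba].
    by exists (a, b); rewrite ?inE /= -?bruhat_le_tperm.
  by exists (b, a); rewrite ?inE /= -?bruhat_le_tperm // tpermC.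
rewrite card_in_imset // => -[a b] [c d]; rewrite !inE /= => /andP[ab _] /andP[cd _] e.
have := congr1 (fun t : 'S_n.+1 => t a) e; rewrite /= tpermL.
case: tpermP => [-> -> //|ad bc|_ _ ba]; move: ab; last by rewrite ba ltnn.
by rewrite ad bc; lia.
Qed.

End Translation.

Lemma smooth_smooth_pair n (s : 'S_n.+1) :
  smooth s = (inv_count n.+1 (nat_perm s) ==
              tperm_count n.+1 (nat_perm s) (nat_perm s^-1%g)).
Proof. by rewrite /smooth inversions_count transpositions_count. Qed.

Lemma essential_lt n f g i j : essential n.+1 f g i j -> i < n /\ j < n.
Proof. by case/and4P. Qed.

Lemma admissible_essential n (s : 'S_n.+1) :
  admissible (Eset s) <->
  admissible_rel (essential n.+1 (nat_perm s) (nat_perm s^-1%g)).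
Proof.
split=> [ad i1 j1 i2 j2 E1 E2 ne|ad i1 j1 i2 j2].
  have [[i1n j1n] [i2n j2n]] := (essential_lt E1, essential_lt E2).
  apply: (ad (Ordinal i1n) (Ordinal j1n) (Ordinal i2n) (Ordinal j2n)).
  - by rewrite Eset_essential.
  - by rewrite Eset_essential.
  - by move=> e; apply: ne; case: e => -> ->.
rewrite !Eset_essential => E1 E2 ne; apply: ad => // e; apply: ne.
by case: e => /val_inj-> /val_inj->.
Qed.

Theorem theorem1p6 (n : nat) (hn : 0 < n) :
  [/\ (forall s : 'S_n, smooth s -> admissible (Eset s)),
      (forall s t : 'S_n, smooth s -> smooth t -> Eset s = Eset t -> s = t)
    & (forall E : {set 'I_n.-1 * 'I_n.-1}, admissible E ->
         exists2 s : 'S_n, smooth s & Eset s = E)].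
Proof.
case: n hn => // n _; split.
- move=> s; rewrite smooth_smooth_pair => /eqP sm; apply/admissible_essential.
  exact: (smooth_pair_essential (perm_pair_nat_perm s) sm).2.
- move=> s t; rewrite !smooth_smooth_pair => /eqP sms /eqP smt eE.
  have [ps pt] := (perm_pair_nat_perm s, perm_pair_nat_perm t).
  apply: nat_perm_inj; apply: (essential_inj ps pt).
  + exact: (smooth_pair_essential ps sms).1.
  + exact: (smooth_pair_essential pt smt).1.
  move=> i j; have Elt := essential_lt (i := i) (j := j) (n := n).
  (* Outside the square of side [n] both sides are false. *)
  have [/andP[ltin ltjn]|out] := boolP ((i < n) && (j < n)).
    by have := Eset_essential s (Ordinal ltin) (Ordinal ltjn); rewrite eE Eset_essential.
  by apply/idP/idP => /Elt[ltin ltjn]; rewrite ltin ltjn in out.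
move=> E adE.
(* [R] extends [E] to [nat], with value false outside the square. *)
pose R i j := [exists p in E, (p.1 == i :> nat) && (p.2 == j :> nat)].
have RP (i j : 'I_n) : R i j = ((i, j) \in E).
  apply/existsP/idP => [[[a b] /=]|Eij]; last by exists (i, j); rewrite Eij !eqxx.
  by case/and3P=> Eab /eqP/val_inj<- /eqP/val_inj<-.
have Rlt i j : R i j -> i < n /\ j < n.
  by case/existsP=> -[a b] /and3P[_ /eqP<- /eqP<-].
have adR : admissible_rel R.
  move=> i1 j1 i2 j2 R1 R2 ne.
  have [[i1n j1n] [i2n j2n]] := (Rlt _ _ R1, Rlt _ _ R2).
  apply: (adE (Ordinal i1n) (Ordinal j1n) (Ordinal i2n) (Ordinal j2n)).
  - by rewrite -RP.
  - by rewrite -RP.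
  - by move=> e; apply: ne; case: e => -> ->.
have [f [g [fg sm _ ess]]] := admissible_realized (n := n.+1) Rlt adR.
have [s [sf sg]] := perm_of_fun fg.
(* Since [s] and [f] agree only below [n.+1], the counts are compared term by term. *)
exists s.
  rewrite smooth_smooth_pair; apply/eqP.
  transitivity (inv_count n.+1 f); last rewrite [LHS]sm.
    by apply: eq_bigr => i _; apply: eq_bigr => j _; rewrite !sf.
  apply: eq_bigr => a _; apply: eq_bigr => b _; congr (nat_of_bool [&& _, _ & _]).
    by apply: eq_in_has => p; rewrite mem_iota => /andP[_ pa]; rewrite sf //; have := ltn_ord a; lia.
  by apply: eq_in_has => p; rewrite mem_iota => /andP[_ pa]; rewrite sg //; have := ltn_ord a; lia.
apply/setP=> -[i j]; rewrite Eset_essential -RP -ess /essential.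
rewrite !ltnS !ltn_ord !sf ?sg // ltnS //; exact: ltnW.
Qed.
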